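(* Let $M$ be an abelian group, $P \subseteq M$, and let $B_1 \subseteq B_2 \subseteq M$ be structuring elements. Then: (a) $O_{B_1}(g)^{-1}(0) \subseteq O_{B_2}(g)^{-1}(0)$ for every $g \in \mathcal{I}_P$ if and only if $B_1 \subseteq_{WS,P,-} B_2$; (b) $C_{B_2}(g)^{-1}(0) \subseteq C_{B_1}(g)^{-1}(0)$ for every $g \in \mathcal{I}_P$ if and only if $B_1 \subseteq_{WS,P,+} B_2$.
   Context: $M$ is an abelian group. An image on $P \subseteq M$ is a function $g : P \to \mathbb{R}_{\geq 0}$; $\mathcal{I}_P$ is the set of all images on $P$. A structuring element is a finite set $B$ with $0 \in B \subseteq M$. For $x \in P$, $B(x;P,+) = \{ b \in B : x + b \in P\}$ and $B(x;P,-) = \{ b \in B : x - b \in P\}$. Erosion: $\epsilon_B(g)(x) = \min\{ g(x+b) : b \in B(x;P,+)\}$; dilation: $\delta_B(g)(x) = \max\{ g(x-b) : b \in B(x;P,-)\}$; opening $O_B = \delta_B \circ \epsilon_B$; closing $C_B = \epsilon_B \circ \delta_B$ (all maps $\mathcal{I}_P \to \mathcal{I}_P$). For an image $h$, $h^{-1}(0) = \{x \in P : h(x) = 0\}$. Weak shift inclusion: $B_1 \subseteq_{WS,P,+} B_2$ means $B_1 \subseteq B_2$ and for every $x \in P$ and $b_2 \in B_2(x;P,+)$ there exists $b_1 \in B_1(x;P,+)$ such that for every $b_1' \in B_1(x + b_1;P,-)$ there is $b_2' \in B_2$ with $x + b_2 - b_2' = x + b_1 - b_1'$. $B_1 \subseteq_{WS,P,-}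 B_2$ means $B_1 \subseteq B_2$ and for every $x \in P$ and $b_2 \in B_2(x;P,-)$ there exists $b_1 \in B_1(x;P,-)$ such that for every $b_1' \in B_1(x - b_1;P,+)$ there is $b_2' \in B_2$ with $x - b_2 + b_2' = x - b_1 + b_1'$. *)

(* Defs.v *)
From mathcomp Require Import all_boot all_order all_algebra finmap.
From mathcomp Require Import boolp classical_sets reals interval_inference.

Set Implicit Arguments.
Unset Strict Implicit.
Unset Printing Implicit Defensive.

Import Order.TTheory GRing.Theory Num.Theory.
Local Open Scope classical_set_scope.
Local Open Scope fset_scope.
Local Open Scope ring_scope.

(* [P : set M] is coerced to the subtype of its elements. *)
Definition image_on (R : realType) (M : zmodType) (P : set M) : Type :=
  P -> {nonneg R}.

Definition structuring_element (M : zmodType) (B : {fset M}) : Prop := 0 \in B.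

(* [Bplus B P x] is B(x;P,+) and [Bminus B P x] is B(x;P,-). *)
Definition Bplus (M : zmodType) (B : {fset M}) (P : set M) (x : M) : {fset M} :=
  [fset b in B | x + b \in P].

Definition Bminus (M : zmodType) (B : {fset M}) (P : set M) (x : M) : {fset M} :=
  [fset b in B | x - b \in P].

Lemma Bplus_in (M : zmodType) (B : {fset M}) (P : set M) (x : M)
  (b : Bplus B P x) : x + val b \in P.
Proof. by have := valP b; rewrite !inE /= => /andP[_]; rewrite inE. Qed.

Lemma Bminus_in (M : zmodType) (B : {fset M}) (P : set M) (x : M)
  (b : Bminus B P x) : x - val b \in P.
Proof. by have := valP b; rewrite !inE /= => /andP[_]; rewrite inE. Qed.

Definition shift_plus (M : zmodType) (B : {fset M}) (P : set M) (x : M)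
  (b : Bplus B P x) : P := exist _ (x + val b) (Bplus_in b).

Definition shift_minus (M : zmodType) (B : {fset M}) (P : set M) (x : M)
  (b : Bminus B P x) : P := exist _ (x - val b) (Bminus_in b).

(* The default value [g x] of the iterated min and max is itself one of the
   values ranged over when [0 \in B], so these are the genuine minimum and
   maximum: see [erosion_min] and [dilation_max] below. *)
Definition erosion (R : realType) (M : zmodType) (P : set M) (B : {fset M})
  (g : image_on R P) : image_on R P :=
  fun x => \big[Order.min/g x]_(b : Bplus B P (val x)) g (shift_plus b).

Definition dilation (R : realType) (M : zmodType) (P : set M) (B : {fset M})
  (g : image_on R P) : image_on R P :=
  fun x => \big[Order.max/g x]_(b : Bminus B P (val x)) g (shift_minus b).

Definition opening (R : realType) (M : zmodType) (P : set M) (B : {fset M})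
  (g : image_on R P) : image_on R P := dilation B (erosion B g).

Definition closing (R : realType) (M : zmodType) (P : set M) (B : {fset M})
  (g : image_on R P) : image_on R P := erosion B (dilation B g).

Definition zero_set (R : realType) (M : zmodType) (P : set M)
  (h : image_on R P) : set P := [set x : P | h x = 0%:nng].

Definition ws_plus (M : zmodType) (P : set M) (B1 B2 : {fset M}) : Prop :=
  B1 `<=` B2 /\
  forall x b2 : M, x \in P -> b2 \in Bplus B2 P x ->
    exists2 b1 : M, b1 \in Bplus B1 P x &
      forall b1' : M, b1' \in Bminus B1 P (x + b1) ->
        exists2 b2' : M, b2' \in B2 & x + b2 - b2' = x + b1 - b1'.

Definition ws_minus (M : zmodType) (P : set M) (B1 B2 : {fset M}) : Prop :=
  B1 `<=` B2 /\
  forall x b2 : M, x \in P -> b2 \in Bminus B2 P x ->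
    exists2 b1 : M, b1 \in Bminus B1 P x &
      forall b1' : M, b1' \in Bplus B1 P (x - b1) ->
        exists2 b2' : M, b2' \in B2 & x - b2 + b2' = x - b1 + b1'.

Lemma erosion_min (R : realType) (M : zmodType) (P : set M) (B : {fset M})
    (g : image_on R P) (x : P) : structuring_element B ->
  (exists b : Bplus B P (val x), erosion B g x = g (shift_plus b)) /\
  (forall b : Bplus B P (val x), erosion B g x <= g (shift_plus b)).
Proof.
move=> B0; split; last by move=> b; exact: bigmin_le.
have x0 : 0 \in Bplus B P (val x) by rewrite !inE /= B0 addr0; exact: valP.
apply: (@big_ind _ (fun v => exists b : Bplus B P (val x), v = g (shift_plus b))).
- by exists [` x0]; congr g; apply: val_inj; rewrite /= addr0.
- move=> u v Hu Hv; by rewrite /Order.min; case: ifP.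
- by move=> b _; exists b.
Qed.

Lemma dilation_max (R : realType) (M : zmodType) (P : set M) (B : {fset M})
    (g : image_on R P) (x : P) : structuring_element B ->
  (exists b : Bminus B P (val x), dilation B g x = g (shift_minus b)) /\
  (forall b : Bminus B P (val x), g (shift_minus b) <= dilation B g x).
Proof.
move=> B0; split; last by move=> b; exact: le_bigmax.
have x0 : 0 \in Bminus B P (val x) by rewrite !inE /= B0 subr0; exact: valP.
apply: (@big_ind _ (fun v => exists b : Bminus B P (val x), v = g (shift_minus b))).
- by exists [` x0]; congr g; apply: val_inj; rewrite /= subr0.
- move=> u v Hu Hv; by rewrite /Order.max; case: ifP.
- by move=> b _; exists b.
Qed.

(* Main.v *)
Require Import Defs.
From mathcomp Require Import all_boot all_order all_algebra finmap.
From mathcomp Require Import boolp classical_sets reals interval_inference.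

(** Whether [opening B g] or [closing B g] vanishes at [x] depends only on the
    zeros of [g]: the opening vanishes iff every translate of [B] inside [P]
    through [x] contains a zero of [g], and the closing vanishes iff some
    reflected translate consists of zeros.  Given weak shift inclusion one
    zero-set condition implies the other; conversely one tests the inclusion of
    zero sets on the indicator of a translate [z + B2], resp. on the indicator
    of the complement of [z - B2]. *)

Set Implicit Arguments.
Unset Strict Implicit.
Unset Printing Implicit Defensive.

Import Order.TTheory GRing.Theory Num.Theory.
Local Open Scope ring_scope.

Section ZeroSets.
Context {R : realType} {M : zmodType} {P : set M}.
Implicit Types (B : {fset M}) (g : image_on R P) (x y z w : P).

Lemma nonneg_le0 (a : {nonneg R}) : a <= 0%:nng -> a = 0%:nng.
Proof. by move=> a0; apply/le_anti; rewrite a0 -num_le /=. Qed.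

Lemma mem_Bplus B (x b : M) : (b \in Bplus B P x) = (b \in B) && (x + b \in P).
Proof. by rewrite !inE. Qed.

Lemma mem_Bminus B (x b : M) : (b \in Bminus B P x) = (b \in B) && (x - b \in P).
Proof. by rewrite !inE. Qed.

Lemma Bplus_diff B x y : val y - val x \in B -> val y - val x \in Bplus B P (val x).
Proof. by move=> yxB; rewrite mem_Bplus yxB addrC subrK; exact: valP. Qed.

Lemma Bminus_diff B x y : val x - val y \in B -> val x - val y \in Bminus B P (val x).
Proof. by move=> xyB; rewrite mem_Bminus xyB subKr; exact: valP. Qed.

(** A minimum of finitely many nonnegative values is attained, so it vanishes exactly when one of
    them does. Naming the point [y] instead of the shift [val y - val x] leaves membership in [P] to
    the type. *)
Lemma erosion_eq0 B g x : structuring_element B ->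
  erosion B g x = 0%:nng <-> exists2 y : P, val y - val x \in B & g y = 0%:nng.
Proof.
move=> B0; have [[b gb] min_g] := erosion_min g x B0; split=> [g0|[y yxB gy]].
  exists (shift_plus b); last by rewrite -gb.
  by have := valP b; rewrite mem_Bplus => /andP[bB _]; rewrite /= addrC addKr.
apply: nonneg_le0; rewrite -gy; have := min_g [` Bplus_diff yxB]%fset.
by congr (_ <= g _); apply: val_inj; rewrite /= addrC subrK.
Qed.

(** Dually, a maximum of nonnegative values bounds each of them, so it vanishes only when all do. *)
Lemma dilation_eq0 B g x : structuring_element B ->
  dilation B g x = 0%:nng <-> forall y, val x - val y \in B -> g y = 0%:nng.
Proof.
move=> B0; have [[b gb] max_g] := dilation_max g x B0; split=> [g0 y xyB|g0].
  apply: nonneg_le0; rewrite -g0; have := max_g [` Bminus_diff xyB]%fset.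
  by congr (g _ <= _); apply: val_inj; rewrite /= subKr.
rewrite gb; apply: g0.
by have := valP b; rewrite mem_Bminus => /andP[bB _]; rewrite /= subKr.
Qed.

Lemma opening_eq0 B g x : structuring_element B ->
  zero_set (opening B g) x <->
  forall y, val x - val y \in B ->
    exists2 w : P, val w - val y \in B & g w = 0%:nng.
Proof.
move=> B0; split=> [/(dilation_eq0 _ _ B0) g0 y /g0 /(erosion_eq0 _ _ B0) //|g0].
by apply/(dilation_eq0 _ _ B0) => y /g0 gy; apply/(erosion_eq0 _ _ B0).
Qed.

Lemma closing_eq0 B g x : structuring_element B ->
  zero_set (closing B g) x <->
  exists2 y : P, val y - val x \in B &
    forall w, val y - val w \in B -> g w = 0%:nng.
Proof.
move=> B0; split=> [/(erosion_eq0 _ _ B0)[y yxB]|[y yxB g0]].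
  by move/(dilation_eq0 _ _ B0) => g0; exists y.
by apply/(erosion_eq0 _ _ B0); exists y => //; apply/(dilation_eq0 _ _ B0).
Qed.

(** Change of variables [z = x - b2], [y = x - b1], [w = y + b1']: the equation forces
    [b2' = w - z], so the inner existential becomes a membership. The condition now reads: each
    translate [z + B2] through [x] contains the part in [P] of some [y + B1] through [x]. *)
Lemma ws_minusP B1 B2 : (B1 `<=` B2)%fset ->
  ws_minus P B1 B2 <->
  forall x z, val x - val z \in B2 ->
    exists2 y : P, val x - val y \in B1 &
      forall w, val w - val y \in B1 -> val w - val z \in B2.
Proof.
move=> sB; split=> [[_ ws] x z xzB|ws].
  have [b1 b1x ws1] := ws _ _ (valP x) (Bminus_diff xzB).
  move: (b1x); rewrite mem_Bminus => /andP[b1B yP].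
  exists (exist _ (_ : M) yP : P) => [|w /Bplus_diff /ws1 [b2' b2'B]]; first by rewrite /= subKr.
  by rewrite /= subKr [RHS]addrC subrK => <-; rewrite addrC addKr.
split=> // x b2 xP; rewrite mem_Bminus => /andP[b2B zP].
have /= [|y xyB ws1] := ws (exist _ x xP) (exist _ (_ : M) zP); first by rewrite /= subKr.
exists (x - val y) => [|b1']; first by rewrite mem_Bminus xyB subKr (valP y).
rewrite subKr mem_Bplus => /andP[b1'B wP].
exists (val y + b1' - (x - b2)); last by rewrite addrC subrK.
by apply: (ws1 (exist _ (_ : M) wP)); rewrite /= addrC addKr.
Qed.

(** The reflected change of variables, [z = x + b2], [y = x + b1], [w = y - b1'], forces
    [b2' = z - w]; the translates compared are [z - B2] and [y - B1]. *)
Lemma ws_plusP B1 B2 : (B1 `<=` B2)%fset ->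
  ws_plus P B1 B2 <->
  forall x z, val z - val x \in B2 ->
    exists2 y : P, val y - val x \in B1 &
      forall w, val y - val w \in B1 -> val z - val w \in B2.
Proof.
move=> sB; split=> [[_ ws] x z zxB|ws].
  have [b1 b1x ws1] := ws _ _ (valP x) (Bplus_diff zxB).
  move: (b1x); rewrite mem_Bplus => /andP[b1B yP].
  exists (exist _ (_ : M) yP : P) => [|w /Bminus_diff /ws1 [b2' b2'B]]; first by rewrite /= addrC addKr.
  by rewrite /= [val x + _]addrC subrK subKr => <-; rewrite subKr.
split=> // x b2 xP; rewrite mem_Bplus => /andP[b2B zP].
have /= [|y yxB ws1] := ws (exist _ x xP) (exist _ (_ : M) zP); first by rewrite /= addrC addKr.
exists (val y - x) => [|b1']; first by rewrite mem_Bplus yxB addrC subrK (valP y).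
rewrite [x + (_ - _)]addrC subrK mem_Bminus => /andP[b1'B wP].
exists (x + b2 - (val y - b1')); last by rewrite subKr.
by apply: (ws1 (exist _ (_ : M) wP)); rewrite /= subKr.
Qed.

Definition indicator (p : pred P) : image_on R P :=
  fun w => if p w then 1%:nng else 0%:nng.

Lemma indicator_eq0 (p : pred P) w : indicator p w = 0%:nng <-> ~~ p w.
Proof.
rewrite /indicator; case: (p w); split=> // /(congr1 (fun a => a%:num)) /= /eqP.
by rewrite oner_eq0.
Qed.

Lemma opening_zero_set_ws_minus B1 B2 :
  structuring_element B1 -> structuring_element B2 -> (B1 `<=` B2)%fset ->
  (forall g, (zero_set (opening B1 g) `<=` zero_set (opening B2 g))%classic)
  <-> ws_minus P B1 B2.
Proof.
move=> B1_0 B2_0 sB; split=> [sub|/(ws_minusP sB) ws g x].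
  apply/(ws_minusP sB) => x z xzB; apply: contrapT => no_y.
  (* This [g] has no zero in [z + B2], a translate through [x], so its opening by [B2] is nonzero at
     [x]. *)
  pose g := indicator (fun w => val w - val z \in B2).
  suff /sub /(opening_eq0 _ _ B2_0) /(_ z xzB) [w wzB /indicator_eq0] :
    zero_set (opening B1 g) x by rewrite wzB.
  (* By [no_y], each [y + B1] through [x] has a point of [P] outside [z + B2], which is a zero of
     [g]. *)
  apply/(opening_eq0 _ _ B1_0) => y xyB; apply: contrapT => no_w.
  apply: no_y; exists y => // w wyB; apply: contrapT => /negP wzB.
  by apply: no_w; exists w => //; apply/indicator_eq0.
move=> /(opening_eq0 _ _ B1_0) g0; apply/(opening_eq0 _ _ B2_0) => z /ws[y xyB ws1].
by have [w /ws1 wzB gw] := g0 y xyB; exists w.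
Qed.

Lemma closing_zero_set_ws_plus B1 B2 :
  structuring_element B1 -> structuring_element B2 -> (B1 `<=` B2)%fset ->
  (forall g, (zero_set (closing B2 g) `<=` zero_set (closing B1 g))%classic)
  <-> ws_plus P B1 B2.
Proof.
move=> B1_0 B2_0 sB; split=> [sub|/(ws_plusP sB) ws g x].
  apply/(ws_plusP sB) => x z zxB.
  (* The zeros of [g] are exactly the points of [z - B2], so [z] witnesses that the closing by [B2]
     vanishes at [x]. The witness [y] for [B1] then has [y - B1] inside that zero set, which is the
     required inclusion. *)
  pose g := indicator (fun w => val z - val w \notin B2).
  have /sub /(closing_eq0 _ _ B1_0) [y yxB g0] : zero_set (closing B2 g) x.
    apply/(closing_eq0 _ _ B2_0); exists z => // w zwB.
    by apply/indicator_eq0; rewrite negbK.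
  by exists y => // w /g0 /indicator_eq0; rewrite negbK.
move=> /(closing_eq0 _ _ B2_0) [z /ws[y yxB ws1] g0].
by apply/(closing_eq0 _ _ B1_0); exists y => // w /ws1 /g0.
Qed.

End ZeroSets.

Theorem theorem6 (R : realType) (M : zmodType) (P : set M) (B1 B2 : {fset M})
    (hB1 : structuring_element B1) (hB2 : structuring_element B2)
    (hB12 : (B1 `<=` B2)%fset) :
  ((forall g : image_on R P,
      (zero_set (opening B1 g) `<=` zero_set (opening B2 g))%classic)
    <-> ws_minus P B1 B2) /\
  ((forall g : image_on R P,
      (zero_set (closing B2 g) `<=` zero_set (closing B1 g))%classic)
    <-> ws_plus P B1 B2).
Proof.
by split; [exact: opening_zero_set_ws_minus | exact: closing_zero_set_ws_plus].
Qed.
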